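(* Let $A\in\mathbb{R}^{d\times n}$ have columns $a_1,\dots,a_n\in\mathbb{R}^d$, let $b\in\mathbb{R}^d$ and $\lambda_1,\lambda_2\ge 0$, and let $x^\star$ be an optimal solution of the elastic net regression problem $$\min_{x\in\mathbb{R}^n}\ \tfrac12\|Ax-b\|_2^2+\lambda_2\|x\|_2^2+\lambda_1\|x\|_1 .$$ Then the following screening rule holds for every $x\in\mathbb{R}^n$ and all $i\in\{1,\dots,n\}$: $$\big|(a_i^\top A+2\lambda_2e_i^\top)x-a_i^\top b\big|<\lambda_1-\sqrt{2\,(a_i^\top a_i+2\lambda_2)\,G(x)}\ \Longrightarrow\ x_i^\star=0 ,$$ where $G(x)$ is the duality gap of this problem at $x$, as defined in the context.
   Context: $e_i$ is the $i$-th standard basis vector of $\mathbb{R}^n$. For a problem of the form $\min_{x\in\mathbb{R}^n} f(Ax)+g(x)$ with $f,g$ closed convex and $f$ differentiable, the dual problem is $\min_{w\in\mathbb{R}^d} f^*(w)+g^*(-A^\top w)$, where $h^*(v)=\sup_u\, v^\top u-h(u)$ denotes the convex conjugate, and the duality gap at $x$ is $$G(x)=f(Ax)+g(x)+f^*(w(x))+g^*(-A^\top w(x)),\qquad w(x)=\nabla f(Ax).$$ For the elastic net regression problem above, $f(u)=\frac12\|u-b\|_2^2$ and $g(x)=\lambda_2\|x\|_2^2+\lambda_1\|x\|_1$, so that $w(x)=Ax-b$. If $G(x)=+\infty$ (possible only when $\lambda_2=0$), the hypothesis of the implication does not hold. *)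

(* Defs.v *)
From mathcomp Require Import all_boot all_order all_algebra.
From mathcomp Require Import all_classical all_reals all_analysis.

Set Implicit Arguments.
Unset Strict Implicit.
Unset Printing Implicit Defensive.

Import Order.TTheory GRing.Theory Num.Theory.
Import numFieldNormedType.Exports.

Local Open Scope classical_set_scope.
Local Open Scope ring_scope.

Definition dot (R : realType) (m : nat) (u v : 'cV[R]_m) : R := (u^T *m v) 0 0.

(* The library norm `|v| of a matrix is the sup norm, hence these two. *)
Definition norm2 (R : realType) (m : nat) (v : 'cV[R]_m) : R :=
  Num.sqrt (\sum_(i < m) v i 0 ^+ 2).

Definition norm1 (R : realType) (m : nat) (v : 'cV[R]_m) : R :=
  \sum_(i < m) `|v i 0|.

(* The library Jacobian is defined for functions of row vectors only. *)
Definition grad (R : realType) (m : nat) (f : 'cV[R]_m -> R) (u : 'cV[R]_m) :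
    'cV[R]_m :=
  \col_(i < m) 'D_(delta_mx i 0) f u.

Definition conjugate (R : realType) (m : nat) (h : 'cV[R]_m -> \bar R)
    (v : 'cV[R]_m) : \bar R :=
  ereal_sup [set ((dot v u)%:E - h u)%E | u in [set: 'cV[R]_m]].

(* Difference at x between the objective of  min_x f (A x) + g x  and that of
   its dual  max_w - f^*(w) - g^*(- A^T w)  at the point  w = grad f (A x). *)
Definition duality_gap (R : realType) (d n : nat) (A : 'M[R]_(d, n))
    (f : 'cV[R]_d -> R) (g : 'cV[R]_n -> \bar R) (x : 'cV[R]_n) : \bar R :=
  let w := grad f (A *m x) in
  ((f (A *m x))%:E + g x
     + conjugate (EFin \o f) w + conjugate g (- (A^T *m w)))%E.

Definition enet_objective (R : realType) (d n : nat) (A : 'M[R]_(d, n))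
    (b : 'cV[R]_d) (lambda1 lambda2 : R) (x : 'cV[R]_n) : R :=
  2^-1 * norm2 (A *m x - b) ^+ 2 + lambda2 * norm2 x ^+ 2 + lambda1 * norm1 x.

Definition enet_loss (R : realType) (d : nat) (b u : 'cV[R]_d) : R :=
  2^-1 * norm2 (u - b) ^+ 2.

Definition enet_penalty (R : realType) (n : nat) (lambda1 lambda2 : R)
    (x : 'cV[R]_n) : R :=
  lambda2 * norm2 x ^+ 2 + lambda1 * norm1 x.

Definition enet_gap (R : realType) (d n : nat) (A : 'M[R]_(d, n))
    (b : 'cV[R]_d) (lambda1 lambda2 : R) (x : 'cV[R]_n) : \bar R :=
  duality_gap A (enet_loss b) (EFin \o enet_penalty lambda1 lambda2) x.

(* Main.v *)
Require Import Defs.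
From mathcomp Require Import all_boot all_order all_algebra.
From mathcomp Require Import all_classical all_reals all_analysis.
From mathcomp Require Import ring lra.

Set Implicit Arguments.
Unset Strict Implicit.
Unset Printing Implicit Defensive.

Import Order.TTheory GRing.Theory Num.Theory.
Import numFieldNormedType.Exports.

Local Open Scope ring_scope.

(** Let [h] be the smooth part of the objective [F] and [B] the Hessian form of
    [h], so that [B e_i e_i = a_i . a_i + 2 lambda2].  Optimality of [xstar]
    and weak duality give [B (x - xstar) (x - xstar) / 2 <= F x - F xstar
    <= G x].  Since [h] is quadratic, the [i]-th partial derivatives of [h] at
    [x] and at [xstar] differ by [B e_i (x - xstar)], which Cauchy-Schwarz
    bounds by [sqrt (2 (a_i . a_i + 2 lambda2) G)].  The screening test thus
    forces the [i]-th partial derivative at [xstar] below [lambda1] in absolute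
    value, and the l1 term then forces [xstar_i = 0]. *)

Lemma dotE (R : realType) (m : nat) (u v : 'cV[R]_m) :
  dot u v = \sum_(i < m) u i 0 * v i 0.
Proof. by rewrite /dot mxE; apply: eq_bigr => i _; rewrite mxE. Qed.

Lemma dotC (R : realType) (m : nat) (u v : 'cV[R]_m) : dot u v = dot v u.
Proof. by rewrite !dotE; apply: eq_bigr => i _; rewrite mulrC. Qed.

Lemma dotDr (R : realType) (m : nat) (u v w : 'cV[R]_m) :
  dot u (v + w) = dot u v + dot u w.
Proof. by rewrite /dot mulmxDr mxE. Qed.

Lemma dotZr (R : realType) (m : nat) (u v : 'cV[R]_m) (c : R) :
  dot u (c *: v) = c * dot u v.
Proof. by rewrite /dot -scalemxAr mxE. Qed.

Lemma dotNr (R : realType) (m : nat) (u v : 'cV[R]_m) :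
  dot u (- v) = - dot u v.
Proof. by rewrite -scaleN1r dotZr mulN1r. Qed.

Lemma dotDl (R : realType) (m : nat) (u v w : 'cV[R]_m) :
  dot (u + v) w = dot u w + dot v w.
Proof. by rewrite !(dotC _ w) dotDr. Qed.

Lemma dotZl (R : realType) (m : nat) (u v : 'cV[R]_m) (c : R) :
  dot (c *: u) v = c * dot u v.
Proof. by rewrite !(dotC _ v) dotZr. Qed.

Lemma dotNl (R : realType) (m : nat) (u v : 'cV[R]_m) :
  dot (- u) v = - dot u v.
Proof. by rewrite !(dotC _ v) dotNr. Qed.

Lemma dot_trmx (R : realType) (d n : nat) (A : 'M[R]_(d, n))
    (w : 'cV[R]_d) (u : 'cV[R]_n) :
  dot (A^T *m w) u = dot w (A *m u).
Proof. by rewrite /dot trmx_mul trmxK mulmxA. Qed.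

Lemma dot_delta (R : realType) (m : nat) (i : 'I_m) (v : 'cV[R]_m) :
  dot (delta_mx i 0) v = v i 0.
Proof. by rewrite /dot trmx_delta -rowE mxE. Qed.

Lemma dot_ge0 (R : realType) (m : nat) (v : 'cV[R]_m) : 0 <= dot v v.
Proof. by rewrite dotE; apply: sumr_ge0 => i _; rewrite -expr2 sqr_ge0. Qed.

Lemma sqr_norm2 (R : realType) (m : nat) (v : 'cV[R]_m) :
  norm2 v ^+ 2 = dot v v.
Proof.
rewrite /norm2 sqr_sqrtr; last by apply: sumr_ge0 => i _; rewrite sqr_ge0.
by rewrite dotE; apply: eq_bigr => i _; rewrite expr2.
Qed.

Lemma norm1D_delta (R : realType) (m : nat) (v : 'cV[R]_m) (i : 'I_m) (s : R) :
  norm1 (v + s *: delta_mx i 0) - norm1 v = `|v i 0 + s| - `|v i 0|.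
Proof.
rewrite /norm1 [in X in X - _](bigD1 i) //= [in X in _ - X](bigD1 i) //=.
rewrite !mxE !eqxx mulr1 [in X in X - _](eq_bigr (fun j => `|v j 0|)).
  by rewrite opprD addrACA subrr addr0.
by move=> j /negPf ji; rewrite !mxE ji mulr0 addr0.
Qed.

(** Holds coordinate by coordinate, by the triangle inequality. Phrased with increments from [x] so
    that it bounds the l1 change along a short step. *)
Lemma norm1_convex (R : realType) (m : nat) (x v : 'cV[R]_m) (t : R) :
  0 <= t <= 1 ->
  norm1 (x + t *: v) <= norm1 x + t * (norm1 (x + v) - norm1 x).
Proof.
move=> /andP[t0 t1]; rewrite /norm1 -sumrB mulr_sumr -big_split /=.
apply: ler_sum => j _; rewrite !mxE.
have -> : x j 0 + t * v j 0 = (1 - t) * x j 0 + t * (x j 0 + v j 0) by ring.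
apply: le_trans (ler_normD _ _) _.
rewrite !normrM (ger0_norm t0) (ger0_norm (_ : 0 <= 1 - t)) ?subr_ge0 //.
by lra.
Qed.

(** The discriminant of a nonnegative polynomial of degree at most 2 is nonpositive. The case
    [r = 0] is included, so this serves semidefinite forms. *)
Lemma quadratic_ge0_discr (R : realType) (p q r : R) :
  (forall t, 0 <= p + 2 * q * t + r * t ^+ 2) -> q ^+ 2 <= p * r.
Proof.
move=> h; pose P := Poly [:: p; 2 * q; r].
have := @deg_le2_poly_ge0 _ P; rewrite size_Poly => /(_ isT).
rewrite !coefE /= => discr_le0.
have : (2 * q) ^+ 2 - 4 * r * p <= 0.
  apply: discr_le0 => t; have := h t.
  by rewrite /P horner_Poly /=; congr (_ <= _); ring.
by rewrite exprMn; lra.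
Qed.

Lemma ge0_of_quadratic_near0 (R : realType) (p q : R) :
  (forall t, 0 < t <= 1 -> 0 <= t * p + t ^+ 2 * q) -> 0 <= p.
Proof.
move=> h; rewrite leNgt; apply/negP => p0.
have q0 : 0 <= `|q| by [].
have s0 : 0 < `|q| - p by lra.
(* This [t] solves p + t |q| = t p, whose right side is negative, whereas dividing the hypothesis by
   [t] gives 0 <= p + t q. *)
pose t := - p / (`|q| - p).
have t0 : 0 < t by rewrite divr_gt0 // oppr_gt0.
have ts : t * (`|q| - p) = - p by rewrite divfK ?gt_eqF.
have t1 : t <= 1 by rewrite ler_pdivrMr //; lra.
have := h t; rewrite t0 t1 => /(_ isT).
rewrite expr2 -mulrA -mulrDr pmulr_rge0 // => hp.
have : t * q <= t * `|q| by rewrite ler_pM2l // ler_norm.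
have : t * p < 0 by rewrite pmulr_rlt0.
by lra.
Qed.

(* Fenchel-Young at [y]; the value of the gradient in the gap is irrelevant. *)
Lemma weak_duality (R : realType) (d n : nat) (A : 'M[R]_(d, n))
    (f : 'cV[R]_d -> R) (g : 'cV[R]_n -> R) (x y : 'cV[R]_n) :
  ((f (A *m x) + g x - (f (A *m y) + g y))%:E
     <= duality_gap A f (EFin \o g) x)%E.
Proof.
rewrite /duality_gap; set w := grad _ _.
have hf : ((dot w (A *m y) - f (A *m y))%:E <= conjugate (EFin \o f) w)%E.
  by apply: ereal_sup_ubound; exists (A *m y).
have hg : ((dot (- (A^T *m w)) y - g y)%:E
    <= conjugate (EFin \o g) (- (A^T *m w)))%E.
  by apply: ereal_sup_ubound; exists y.
apply: le_trans (leeD (leeD2l _ hf) hg).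
by rewrite -!EFinD lee_fin dotNl dot_trmx; lra.
Qed.

(** The Hessian form [B] of the smooth part; for [lambda2 = 0] it may be degenerate. *)
Definition enet_form (R : realType) (d n : nat) (A : 'M[R]_(d, n))
    (lambda2 : R) (u v : 'cV[R]_n) : R :=
  dot (A *m u) (A *m v) + 2 * lambda2 * dot u v.

(** The gradient of the smooth part, in closed form: the exact expansion [enet_objectiveD] takes the
    place of differentiation. *)
Definition enet_grad (R : realType) (d n : nat) (A : 'M[R]_(d, n))
    (b : 'cV[R]_d) (lambda2 : R) (x : 'cV[R]_n) : 'cV[R]_n :=
  A^T *m (A *m x - b) + (2 * lambda2) *: x.

Lemma enet_form_ge0 (R : realType) (d n : nat) (A : 'M[R]_(d, n))
    (lambda2 : R) (v : 'cV[R]_n) :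
  0 <= lambda2 -> 0 <= enet_form A lambda2 v v.
Proof. by move=> l0; rewrite addr_ge0 ?dot_ge0 // !mulr_ge0 ?dot_ge0. Qed.

Lemma enet_form_CauchySchwarz (R : realType) (d n : nat) (A : 'M[R]_(d, n))
    (lambda2 : R) (u v : 'cV[R]_n) :
  0 <= lambda2 ->
  enet_form A lambda2 u v ^+ 2
    <= enet_form A lambda2 u u * enet_form A lambda2 v v.
Proof.
move=> l0; apply: quadratic_ge0_discr => t.
have -> : enet_form A lambda2 u u + 2 * enet_form A lambda2 u v * t
    + enet_form A lambda2 v v * t ^+ 2
    = enet_form A lambda2 (u + t *: v) (u + t *: v).
  rewrite /enet_form mulmxDr -scalemxAr !(dotDl, dotDr, dotZl, dotZr).
  rewrite (dotC v u) (dotC (A *m v)); ring.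
exact: enet_form_ge0.
Qed.

Lemma enet_gradB (R : realType) (d n : nat) (A : 'M[R]_(d, n))
    (b : 'cV[R]_d) (lambda2 : R) (x y u : 'cV[R]_n) :
  dot u (enet_grad A b lambda2 x) - dot u (enet_grad A b lambda2 y)
    = enet_form A lambda2 u (x - y).
Proof.
rewrite /enet_grad /enet_form !dotDr !dotZr !(dotC u (_ *m _)) !dot_trmx.
rewrite mulmxBr !(dotDl, dotNl, dotDr, dotNr) !(dotC (A *m u)); ring.
Qed.

(** Second-order Taylor expansion, exact because the smooth part is quadratic; the l1 increment is
    kept as it is. *)
Lemma enet_objectiveD (R : realType) (d n : nat) (A : 'M[R]_(d, n))
    (b : 'cV[R]_d) (lambda1 lambda2 : R) (x v : 'cV[R]_n) :
  enet_objective A b lambda1 lambda2 (x + v)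
    = enet_objective A b lambda1 lambda2 x + dot v (enet_grad A b lambda2 x)
      + 2^-1 * enet_form A lambda2 v v + lambda1 * (norm1 (x + v) - norm1 x).
Proof.
rewrite /enet_objective /enet_grad /enet_form !sqr_norm2.
rewrite (dotDr v) dotZr (dotC v (_ *m _)) dot_trmx mulmxDr.
rewrite !(dotDl, dotNl, dotDr, dotNr).
rewrite (dotC v x) (dotC (A *m v) (A *m x)) (dotC (A *m v) b); by field.
Qed.

(** First-order optimality without subdifferentials: compare [x] with [x + t *: v]. Convexity makes
    the l1 change at most linear in [t], and the Hessian term is of order t^2, so it disappears as
    [t] tends to 0. *)
Lemma enet_minimizer_subgradient (R : realType) (d n : nat)
    (A : 'M[R]_(d, n)) (b : 'cV[R]_d) (lambda1 lambda2 : R)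
    (x v : 'cV[R]_n) :
  0 <= lambda1 ->
  (forall y, enet_objective A b lambda1 lambda2 x
               <= enet_objective A b lambda1 lambda2 y) ->
  0 <= dot v (enet_grad A b lambda2 x) + lambda1 * (norm1 (x + v) - norm1 x).
Proof.
move=> l0 xmin.
apply: (@ge0_of_quadratic_near0 _ _ (2^-1 * enet_form A lambda2 v v)).
move=> t /andP[t0 t1]; have := xmin (x + t *: v).
have /(ler_wpM2l l0) : norm1 (x + t *: v) - norm1 x
    <= t * (norm1 (x + v) - norm1 x).
  by rewrite lerBlDl norm1_convex // (ltW t0).
rewrite enet_objectiveD dotZl /enet_form -scalemxAr !(dotZl, dotZr).
nra.
Qed.

(** In the expansion at [x], first-order optimality makes the linear and l1 terms jointly
    nonnegative, which leaves the Hessian term. *)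
Lemma enet_minimizer_growth (R : realType) (d n : nat)
    (A : 'M[R]_(d, n)) (b : 'cV[R]_d) (lambda1 lambda2 : R)
    (x y : 'cV[R]_n) :
  0 <= lambda1 ->
  (forall z, enet_objective A b lambda1 lambda2 x
               <= enet_objective A b lambda1 lambda2 z) ->
  2^-1 * enet_form A lambda2 (y - x) (y - x)
    <= enet_objective A b lambda1 lambda2 y
       - enet_objective A b lambda1 lambda2 x.
Proof.
move=> l0 xmin; have := enet_minimizer_subgradient (y - x) l0 xmin.
have := enet_objectiveD A b lambda1 lambda2 x (y - x).
by rewrite addrC subrK addrC => ->; lra.
Qed.

Lemma enet_minimizer_eq0 (R : realType) (d n : nat)
    (A : 'M[R]_(d, n)) (b : 'cV[R]_d) (lambda1 lambda2 : R)
    (x : 'cV[R]_n) (i : 'I_n) :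
  0 <= lambda1 ->
  (forall y, enet_objective A b lambda1 lambda2 x
               <= enet_objective A b lambda1 lambda2 y) ->
  `|enet_grad A b lambda2 x i 0| < lambda1 -> x i 0 = 0.
Proof.
move=> l0 xmin; set c := enet_grad A b lambda2 x => cl.
(* The direction that sets coordinate [i] to zero: the l1 term gains lambda1 |x_i|, more than the
   linear term can cost unless x_i = 0. *)
have := enet_minimizer_subgradient ((- x i 0) *: delta_mx i 0) l0 xmin.
rewrite norm1D_delta subrr normr0 sub0r dotZl dot_delta -/c => h.
have [//|x_neq0] := eqVneq (x i 0) 0; exfalso.
have x0 : 0 < `|x i 0| by rewrite normr_gt0.
have : - x i 0 * c i 0 <= `|x i 0| * `|c i 0|.
  by rewrite -normrM mulNr -normrN ler_norm.
have : `|x i 0| * `|c i 0| < `|x i 0| * lambda1 by rewrite ltr_pM2l.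
by lra.
Qed.

Theorem corollary17 (R : realType) (d n : nat) (A : 'M[R]_(d, n))
    (b : 'cV[R]_d) (lambda1 lambda2 : R)
    (hlambda1 : 0 <= lambda1) (hlambda2 : 0 <= lambda2)
    (xstar : 'cV[R]_n)
    (hxstar : forall y : 'cV[R]_n,
       enet_objective A b lambda1 lambda2 xstar
         <= enet_objective A b lambda1 lambda2 y)
    (x : 'cV[R]_n) (i : 'I_n) :
  let a : 'cV[R]_d := col i A in
  let e : 'cV[R]_n := delta_mx i 0 in
  let G : \bar R := enet_gap A b lambda1 lambda2 x in
  (G < +oo)%E ->
  (`|((a^T *m A + (2 * lambda2) *: e^T) *m x - a^T *m b) 0 0|%:E
     < lambda1%:E - sqrte ((2 * (dot a a + 2 * lambda2))%:E * G))%E ->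
  xstar i 0 = 0.
Proof.
move=> a e G Gfin.
have G_ge : ((2^-1 * enet_form A lambda2 (x - xstar) (x - xstar))%:E <= G)%E.
  apply: le_trans (weak_duality A _ _ x xstar); rewrite lee_fin.
  have := enet_minimizer_growth x hlambda1 hxstar.
  by rewrite /enet_objective /enet_loss /enet_penalty !addrA.
(* The value +oo contradicts [Gfin] and -oo contradicts the lower bound [G_ge], so the gap is a real
   [g]. *)
clearbody G; case: G Gfin G_ge => [g _||] //; rewrite lee_fin => g_ge.
rewrite -EFinM /= -EFinB lte_fin.
have -> : ((a^T *m A + (2 * lambda2) *: e^T) *m x - a^T *m b) 0 0
    = dot e (enet_grad A b lambda2 x).
  rewrite /a tr_col /e trmx_delta rowE.
  rewrite /dot /enet_grad trmx_delta mulmxDl mulmxDr mulmxBr mulmxBr.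
  by rewrite -scalemxAr -scalemxAl !mulmxA addrAC.
have -> : dot a a + 2 * lambda2 = enet_form A lambda2 e e.
  by rewrite /enet_form /e -colE dot_delta !mxE !eqxx mulr1.
set K := enet_form A lambda2 e e => lt_lambda1.
apply: (enet_minimizer_eq0 hlambda1 hxstar); rewrite -dot_delta -/e.
(* By the triangle inequality, this bound and the screening test carry the strict bound by [lambda1]
   from [x] to [xstar]. *)
suff : `|dot e (enet_grad A b lambda2 x) - dot e (enet_grad A b lambda2 xstar)|
    <= Num.sqrt (2 * K * g).
  by have := lerB_dist (dot e (enet_grad A b lambda2 xstar))
    (dot e (enet_grad A b lambda2 x)); rewrite distrC; lra.
rewrite enet_gradB -sqrtr_sqr ler_wsqrtr //.
apply: le_trans (enet_form_CauchySchwarz A e (x - xstar) hlambda2) _.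
by rewrite -/K (mulrC 2) -mulrA ler_wpM2l ?enet_form_ge0 //; lra.
Qed.
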